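(* For $\sigma>0$ let $\mathcal H_\sigma$ denote the RKHS of the Gaussian kernel $k_\sigma(x,y) = \exp(-\|x-y\|^2/(2\sigma^2))$ on $\mathbb R^d$, with norm $\|\cdot\|_\sigma$. Let $\mathbb P$ be a probability distribution on $\mathbb R^d$, let $x_1,\dots,x_n$ be i.i.d. from $\mathbb P$, and let $\hat{\mathbb P}_n = \frac1n\sum_i \delta_{x_i}$. Let $h$ be a target function satisfying $\|h^2\|_{\sigma/\sqrt2} \leq \Lambda_{h^2}$ and $\|h\|_\sigma \leq \Lambda_h$. For a distribution $\mathbb Q$ write $R_{\mathbb Q}(f) = \mathbb{E}_{x\sim\mathbb Q}[(f(x)-h(x))^2]$. Then for any $\delta>0$, with probability at least $1-\delta$, the following holds simultaneously for all functions $f$ satisfying $\|f^2\|_{\sigma/\sqrt2} \leq \Lambda_{f^2}$ and $\|f\|_\sigma \leq \Lambda_f$: $$R_{\mathbb P}(f) \leq R_{\hat{\mathbb P}_n}(f) + \frac{2}{\sqrt n}\left(1 + \sqrt{\frac{\log(1/\delta)}{2}}\right)\left(\Lambda_{f^2} + \Lambda_{h^2} + 2\Lambda_f\Lambda_h\right).$$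
   Context: Here $f^2, h^2$ denote pointwise squares, and the condition $\|f^2\|_{\sigma/\sqrt2}\le\Lambda_{f^2}$ includes $f^2 \in \mathcal H_{\sigma/\sqrt2}$. *)

(* Defs.v *)
From HB Require Import structures.
From mathcomp Require Import all_boot all_order all_algebra.
From mathcomp Require Import all_classical all_reals all_analysis.
Set Implicit Arguments. Unset Strict Implicit. Unset Printing Implicit Defensive.
Import Order.TTheory GRing.Theory Num.Theory.
Import numFieldNormedType.Exports.
Local Open Scope classical_set_scope.
Local Open Scope ring_scope.

Section Defs.
Variable R : realType.

(** Squared Euclidean distance on R^d, points of R^d being d.-tuple R
    (which carries the product sigma-algebra of MathComp-Analysis). *)
Definition sqdist (d : nat) (x y : d.-tuple R) : R :=
  \sum_(i < d) (tnth x i - tnth y i) ^+ 2.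

Definition gauss_kernel (d : nat) (sigma : R) (x y : d.-tuple R) : R :=
  expR (- sqdist x y / (2 * sigma ^+ 2)).

(** Moore--Aronszajn construction of the RKHS of a kernel k on T.
    Elements of the pre-Hilbert space H_0 = span{k(x,.)} are represented
    by finite lists of (coefficient, centre) pairs. *)
Variable T : Type.
Variable k : T -> T -> R.

Definition comb_eval (c : seq (R * T)) (x : T) : R :=
  \sum_(p <- c) p.1 * k p.2 x.

Definition comb_sqnorm (c : seq (R * T)) : R :=
  \sum_(p <- c) \sum_(q <- c) p.1 * q.1 * k p.2 q.2.

Definition comb_sub (c c' : seq (R * T)) : seq (R * T) :=
  c ++ [seq (- p.1, p.2) | p <- c'].

(** [rkhs_norm_le f L] : f belongs to the RKHS H_k and ||f||_{H_k} <= L.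
    H_k is the set of functions that are pointwise limits of H_0-Cauchy
    sequences, and ||f|| = lim ||f_m||_{H_0} (independent of the sequence). *)
Definition rkhs_norm_le (f : T -> R) (L : R) : Prop :=
  exists u : nat -> seq (R * T),
    (forall x, comb_eval (u m) x @[m --> \oo] --> f x) /\
    (forall e : R, 0 < e -> exists N : nat, forall m p : nat,
        (N <= m)%N -> (N <= p)%N ->
        Num.sqrt (comb_sqnorm (comb_sub (u m) (u p))) <= e) /\
    (forall e : R, 0 < e -> exists N : nat, forall m : nat,
        (N <= m)%N -> Num.sqrt (comb_sqnorm (u m)) <= L + e).
End Defs.

Definition gauss_rkhs_norm_le (R : realType) (d : nat) (sigma : R)
    (f : d.-tuple R -> R) (L : R) : Prop :=
  rkhs_norm_le (@gauss_kernel R d sigma) f L.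

Section Indep.
Local Open Scope ereal_scope.
Definition mutually_independent (R : realType) (dO : measure_display)
    (Omega : measurableType dO) (Pr : probability Omega R)
    (dT : measure_display) (T : measurableType dT) (n : nat)
    (X : 'I_n -> Omega -> T) : Prop :=
  forall (J : {set 'I_n}) (B : 'I_n -> set T),
    (forall i, measurable (B i)) ->
    Pr (\bigcap_(i in [set i | i \in J]) (X i @^-1` B i)) =
    \prod_(i in J) Pr (X i @^-1` B i).

Definition identically_distributed (R : realType) (dO : measure_display)
    (Omega : measurableType dO) (Pr : probability Omega R)
    (dT : measure_display) (T : measurableType dT) (P : probability T R)
    (n : nat) (X : 'I_n -> Omega -> T) : Prop :=
  forall (i : 'I_n) (B : set T), measurable B -> Pr (X i @^-1` B) = P B.
End Indep.

(* Main.v *)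
Require Import Defs.
From HB Require Import structures.
From mathcomp Require Import all_boot all_order all_algebra.
From mathcomp Require Import all_classical all_reals all_analysis measurable_realfun.
From mathcomp Require Import ring lra.
Set Implicit Arguments. Unset Strict Implicit. Unset Printing Implicit Defensive.
Import Order.TTheory GRing.Theory Num.Theory.
Import numFieldNormedType.Exports.
Local Open Scope classical_set_scope.
Local Open Scope ring_scope.

(**
  On pairs of points, the product kernel [K((x,y),(x',y')) = k_sigma(x,x') k_sigma(y,y')]
  restricts to [k_(sigma / sqrt 2)] on the diagonal. Hence [f^2], [h^2] and the product
  [f h] are all evaluations, on the diagonal, of vectors of the RKHS of [K], the last one of
  norm at most [|f| |h|] (that of a pure tensor), and [(f - h)^2] comes from a vector of norm
  at most [M = Lf2 + Lh2 + 2 Lf Lh]. By Cauchy-Schwarz the gap between the two risks is at most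
  [M / n] times the norm of [sum_i (K_(x_i,x_i) - mu)], where [mu] is the mean embedding of the
  law of [(x,x)]. Replacing one sample moves this norm by at most [2], and its second moment is
  at most [n], so McDiarmid's inequality bounds its upper tail.
*)

(** * Positive semidefinite kernels *)

Lemma discriminant_le (R : realFieldType) (A B C : R) : 0 <= A -> 0 <= C ->
  (forall t, 0 <= A + 2 * t * B + t ^+ 2 * C) -> B ^+ 2 <= A * C.
Proof.
move=> A0 C0 q0; have [C1|C1] := eqVneq C 0; last first.
  have Cgt : 0 < C by rewrite lt_def C1.
  have := q0 (- B / C); rewrite -(pmulr_lge0 _ Cgt).
  by rewrite (_ : (_ + _ + _) * C = A * C - B ^+ 2) ?subr_ge0 //; field.
have [->|B1] := eqVneq B 0; first by rewrite expr0n mulr_ge0.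
have := q0 (- (A + 1) / (2 * B)).
by rewrite C1 mulr0 addr0 (_ : A + _ = -1) ?oppr_ge0 ?ler10 //; field.
Qed.

Section Combinations.
Variables (R : realType) (S : Type).
Implicit Types (K : S -> S -> R) (c w : seq (R * S)).

Definition comb_ip K c w : R := \sum_(q <- w) q.1 * comb_eval K c q.2.

Definition comb_norm K c : R := Num.sqrt (comb_sqnorm K c).

Definition comb_scale (a : R) c : seq (R * S) := [seq (a * p.1, p.2) | p <- c].

Definition psd_kernel K : Prop :=
  (forall s t, K s t = K t s) /\ forall c, 0 <= comb_sqnorm K c.

Lemma comb_eval_nil K s : comb_eval K [::] s = 0.
Proof. exact: big_nil. Qed.

Lemma comb_eval_cons K p c s : comb_eval K (p :: c) s = p.1 * K p.2 s + comb_eval K c s.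
Proof. exact: big_cons. Qed.

Lemma comb_eval_cat K c w s : comb_eval K (c ++ w) s = comb_eval K c s + comb_eval K w s.
Proof. exact: big_cat. Qed.

Lemma comb_eval_scale K a c s : comb_eval K (comb_scale a c) s = a * comb_eval K c s.
Proof. by rewrite /comb_eval big_map mulr_sumr; apply: eq_bigr => p _; rewrite mulrA. Qed.

Lemma comb_ipE K c w :
  comb_ip K c w = \sum_(p <- c) \sum_(q <- w) p.1 * q.1 * K p.2 q.2.
Proof.
rewrite exchange_big; apply: eq_bigr => q _; rewrite mulr_sumr.
by apply: eq_bigr => p _; ring.
Qed.

Lemma comb_sqnormE K c : comb_sqnorm K c = comb_ip K c c.
Proof. by rewrite comb_ipE. Qed.

Lemma comb_ip_catl K c c' w : comb_ip K (c ++ c') w = comb_ip K c w + comb_ip K c' w.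
Proof.
rewrite /comb_ip -big_split; apply: eq_bigr => q _ /=.
by rewrite comb_eval_cat mulrDr.
Qed.

Lemma comb_ip_catr K c w w' : comb_ip K c (w ++ w') = comb_ip K c w + comb_ip K c w'.
Proof. exact: big_cat. Qed.

Lemma comb_ip_scalel K a c w : comb_ip K (comb_scale a c) w = a * comb_ip K c w.
Proof.
rewrite /comb_ip mulr_sumr; apply: eq_bigr => q _.
by rewrite comb_eval_scale mulrCA.
Qed.

Lemma comb_ip_scaler K a c w : comb_ip K c (comb_scale a w) = a * comb_ip K c w.
Proof. by rewrite /comb_ip big_map mulr_sumr; apply: eq_bigr => q _; rewrite mulrA. Qed.

Lemma comb_sqnorm_scale K a c : comb_sqnorm K (comb_scale a c) = a ^+ 2 * comb_sqnorm K c.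
Proof. by rewrite !comb_sqnormE comb_ip_scalel comb_ip_scaler mulrA. Qed.

Lemma comb_norm_scale K a c : comb_norm K (comb_scale a c) = `|a| * comb_norm K c.
Proof. by rewrite /comb_norm comb_sqnorm_scale sqrtrM ?sqr_ge0 // sqrtr_sqr. Qed.

Lemma comb_norm_ge0 K c : 0 <= comb_norm K c.
Proof. exact: sqrtr_ge0. Qed.

Lemma comb_norm_seq1 K a s : comb_norm K [:: (a, s)] = `|a| * Num.sqrt (K s s).
Proof. by rewrite /comb_norm /comb_sqnorm !big_seq1 -expr2 sqrtrM ?sqr_ge0 // sqrtr_sqr. Qed.

Lemma comb_ip_seq1 K a s c : comb_ip K c [:: (a, s)] = a * comb_eval K c s.
Proof. exact: big_seq1. Qed.

Section SymmetricKernel.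
Variable K : S -> S -> R.
Hypothesis Ksym : forall s t, K s t = K t s.

Lemma comb_ipC c w : comb_ip K c w = comb_ip K w c.
Proof.
rewrite comb_ipE; apply: eq_bigr => p _; rewrite mulr_sumr.
by apply: eq_bigr => q _; rewrite Ksym mulrA.
Qed.

Lemma comb_sqnorm_cat c w :
  comb_sqnorm K (c ++ w) = comb_sqnorm K c + 2 * comb_ip K c w + comb_sqnorm K w.
Proof. by rewrite !comb_sqnormE comb_ip_catl !comb_ip_catr (comb_ipC w c); ring. Qed.

Lemma comb_sqnorm_cons a s c : comb_sqnorm K ((a, s) :: c) =
  a ^+ 2 * K s s + 2 * a * comb_eval K c s + comb_sqnorm K c.
Proof.
rewrite -cat1s comb_sqnorm_cat comb_ipC comb_ip_seq1 mulrA.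
by rewrite /comb_sqnorm !big_seq1.
Qed.

Lemma eq_comb_sqnorm c w :
  comb_eval K c =1 comb_eval K w -> comb_sqnorm K c = comb_sqnorm K w.
Proof.
move=> cw; have ipE v : comb_ip K c v = comb_ip K w v by apply: eq_bigr => q _; rewrite cw.
by rewrite !comb_sqnormE ipE comb_ipC ipE.
Qed.

Lemma eq_comb_norm c w :
  comb_eval K c =1 comb_eval K w -> comb_norm K c = comb_norm K w.
Proof. by move=> /eq_comb_sqnorm; rewrite /comb_norm => ->. Qed.

End SymmetricKernel.

Section PsdKernel.
Variable K : S -> S -> R.
Hypothesis psdK : psd_kernel K.

Lemma psd_kernel_diag_ge0 s : 0 <= K s s.
Proof. by have := psdK.2 [:: (1, s)]; rewrite /comb_sqnorm !big_seq1 !mul1r. Qed.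

Lemma sqr_comb_norm c : comb_norm K c ^+ 2 = comb_sqnorm K c.
Proof. by rewrite sqr_sqrtr //; exact: psdK.2. Qed.

Lemma comb_ip_le_norm c w : `|comb_ip K c w| <= comb_norm K c * comb_norm K w.
Proof.
rewrite -sqrtr_sqr /comb_norm -sqrtrM; last exact: psdK.2.
apply: ler_wsqrtr; apply: discriminant_le; [exact: psdK.2..|] => t.
have := psdK.2 (c ++ comb_scale t w).
by rewrite (comb_sqnorm_cat psdK.1) comb_ip_scaler comb_sqnorm_scale mulrA.
Qed.

Lemma comb_norm_cat c w : comb_norm K (c ++ w) <= comb_norm K c + comb_norm K w.
Proof.
rewrite -(@ler_sqr _ (comb_norm K _)) ?nnegrE ?addr_ge0 ?comb_norm_ge0 //.
rewrite sqrrD !sqr_comb_norm (comb_sqnorm_cat psdK.1).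
have := le_trans (ler_norm _) (comb_ip_le_norm c w); lra.
Qed.

Lemma comb_eval_le_norm c s : `|comb_eval K c s| <= Num.sqrt (K s s) * comb_norm K c.
Proof.
have := comb_ip_le_norm c [:: (1, s)].
by rewrite comb_ip_seq1 comb_norm_seq1 normr1 !mul1r mulrC.
Qed.

Lemma comb_norm_diff_le2 s t : K s s <= 1 -> K t t <= 1 ->
  comb_norm K [:: (1, s); (-1, t)] <= 2.
Proof.
move=> Ks1 Kt1; apply: (le_trans (comb_norm_cat [:: _] [:: _])).
rewrite !comb_norm_seq1 normrN normr1 !mul1r.
by rewrite -[leRHS]/(1 + 1) -[1]sqrtr1 lerD ?ler_wsqrtr.
Qed.

End PsdKernel.
End Combinations.

Section Reindexing.
Variables (R : realType) (S S' : Type) (K : S' -> S' -> R) (phi : S -> S').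
Implicit Type c : seq (R * S).

Definition comb_map c : seq (R * S') := [seq (p.1, phi p.2) | p <- c].

Lemma comb_sqnorm_map c :
  comb_sqnorm K (comb_map c) = comb_sqnorm (fun s t => K (phi s) (phi t)) c.
Proof. by rewrite /comb_sqnorm big_map; apply: eq_bigr => p _; rewrite big_map. Qed.

Lemma comb_eval_map c s :
  comb_eval K (comb_map c) (phi s) = comb_eval (fun s t => K (phi s) (phi t)) c s.
Proof. exact: big_map. Qed.

End Reindexing.

Section PsdClosure.
Variables (R : realType) (S : Type).
Implicit Types (K L : S -> S -> R).

Lemma eq_psd_kernel K L : (forall s t, K s t = L s t) -> psd_kernel K -> psd_kernel L.
Proof. by move=> KL; have -> : K = L by apply/funext => s; apply/funext => t. Qed.

Lemma psd_kernel_cst1 : psd_kernel (fun _ _ : S => 1 : R).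
Proof.
split=> // c; suff -> : comb_sqnorm (fun _ _ : S => 1) c = (\sum_(p <- c) p.1) ^+ 2.
  exact: sqr_ge0.
rewrite expr2 /comb_sqnorm mulr_suml; apply: eq_bigr => p _.
by rewrite mulr_sumr; apply: eq_bigr => q _; rewrite mulr1.
Qed.

Lemma psd_kernel_rank1M K (phi : S -> R) :
  psd_kernel K -> psd_kernel (fun s t => phi s * phi t * K s t).
Proof.
move=> [Ksym K0]; split=> [s t|c]; first by rewrite Ksym (mulrC (phi s)).
suff -> : comb_sqnorm (fun s t => phi s * phi t * K s t) c =
  comb_sqnorm K [seq (p.1 * phi p.2, p.2) | p <- c] by exact: K0.
rewrite /comb_sqnorm big_map; apply: eq_bigr => p _; rewrite big_map.
by apply: eq_bigr => q _ /=; ring.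
Qed.

Lemma psd_kernelD K L :
  psd_kernel K -> psd_kernel L -> psd_kernel (fun s t => K s t + L s t).
Proof.
move=> [Ksym K0] [Lsym L0]; split=> [s t|c]; first by rewrite Ksym Lsym.
suff -> : comb_sqnorm (fun s t => K s t + L s t) c = comb_sqnorm K c + comb_sqnorm L c.
  exact: addr_ge0.
rewrite /comb_sqnorm -big_split; apply: eq_bigr => p _; rewrite -big_split.
by apply: eq_bigr => q _ /=; ring.
Qed.

Lemma psd_kernel_lim (Km : nat -> S -> S -> R) K :
  (forall m, psd_kernel (Km m)) ->
  (forall s t, Km m s t @[m --> \oo] --> K s t) -> psd_kernel K.
Proof.
move=> psdKm KmK; split=> [s t|c].
  apply: (norm_cvg_unique (KmK s t)).
  by rewrite /= (eq_cvg _ _ (fun m => (psdKm m).1 s t)); exact: KmK.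
have cvc : comb_sqnorm (Km m) c @[m --> \oo] --> comb_sqnorm K c.
  apply: (cvg_big add_continuous) => p _; apply: (cvg_big add_continuous) => q _.
  by apply: cvgM; [exact: cvg_cst|exact: KmK].
by apply: (cvgr_to_ge cvc); apply: nearW => m; exact: (psdKm m).2.
Qed.

Lemma psd_kernel_expM K (phi : S -> R) :
  psd_kernel K -> psd_kernel (fun s t => expR (phi s * phi t) * K s t).
Proof.
move=> psdK; apply: (@psd_kernel_lim
  (fun m s t => series (exp_coeff (phi s * phi t)) m * K s t)); last first.
  by move=> s t; apply: cvgM; [exact: is_cvg_series_exp_coeff|exact: cvg_cst].
elim=> [|m IH].
  apply: eq_psd_kernel (psd_kernel_rank1M (fun=> 0) psdK) => s t.
  by rewrite /series /= big_geq // !mul0r.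
apply: eq_psd_kernel (psd_kernelD IH (psd_kernel_rank1M
  (fun s => phi s ^+ m * Num.sqrt (m`!%:R^-1)) psdK)) => s t.
rewrite /series /= big_nat_recr //= mulrDl; congr (_ + _ * _).
by rewrite /exp_coeff /= exprMn mulrACA -expr2 sqr_sqrtr // invr_ge0.
Qed.

Lemma psd_kernel_exp_sumM (I : Type) (r : seq I) (phi : I -> S -> R) K :
  psd_kernel K -> psd_kernel (fun s t => expR (\sum_(i <- r) phi i s * phi i t) * K s t).
Proof.
move=> psdK; elim: r => [|i r IH].
  by apply: eq_psd_kernel psdK => s t; rewrite big_nil expR0 mul1r.
apply: eq_psd_kernel (psd_kernel_expM (phi i) IH) => s t.
by rewrite big_cons expRD mulrA.
Qed.

End PsdClosure.

(** * Bounded random variables and Hoeffding's lemma *)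

Section BoundedMeasurable.
Variables (R : realType) (d : measure_display) (T : measurableType d).
Implicit Types f g : T -> R.

Definition bounded_measurable f : Prop :=
  measurable_fun setT f /\ exists M : R, forall x, `|f x| <= M.

Lemma bounded_measurable_cst (a : R) : bounded_measurable (fun=> a).
Proof. by split; [exact: measurable_cst|exists `|a|]. Qed.

Lemma bounded_measurableD f g : bounded_measurable f -> bounded_measurable g ->
  bounded_measurable (fun x => f x + g x).
Proof.
move=> [mf [M fM]] [mg [N gN]]; split; first exact: measurable_funD.
by exists (M + N) => x; rewrite (le_trans (ler_normD _ _)) // lerD.
Qed.

Lemma bounded_measurableN f : bounded_measurable f -> bounded_measurable (fun x => - f x).
Proof.
move=> [mf [M fM]]; split; first exact: measurableT_comp.
by exists M => x; rewrite normrN.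
Qed.

Lemma bounded_measurableM f g : bounded_measurable f -> bounded_measurable g ->
  bounded_measurable (fun x => f x * g x).
Proof.
move=> [mf [M fM]] [mg [N gN]]; split; first exact: measurable_funM.
by exists (M * N) => x; rewrite normrM ler_pM.
Qed.

Lemma bounded_measurableX f k :
  bounded_measurable f -> bounded_measurable (fun x => f x ^+ k).
Proof.
move=> [mf [M fM]]; split; first exact: measurable_funX.
by exists (M ^+ k) => x; rewrite normrX lerXn2r ?nnegrE // (le_trans _ (fM x)).
Qed.

Lemma bounded_measurable_expR f :
  bounded_measurable f -> bounded_measurable (fun x => expR (f x)).
Proof.
move=> [mf [M fM]]; split; first exact: measurableT_comp.
exists (expR M) => x; rewrite ger0_norm ?expR_ge0 // ler_expR.
exact: le_trans (ler_norm _) (fM x).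
Qed.

Lemma bounded_measurable_sqrt f :
  bounded_measurable f -> bounded_measurable (fun x => Num.sqrt (f x)).
Proof.
move=> [mf [M fM]]; split.
  apply: measurableT_comp => //; apply: continuous_measurable_fun.
  exact: sqrt_continuous.
exists (Num.sqrt M) => x; rewrite ger0_norm ?sqrtr_ge0 // ler_wsqrtr //.
exact: le_trans (ler_norm _) (fM x).
Qed.

Lemma bounded_measurable_sum (I : Type) (r : seq I) (f : I -> T -> R) :
  (forall i, bounded_measurable (f i)) ->
  bounded_measurable (fun x => \sum_(i <- r) f i x).
Proof.
move=> bf; elim: r => [|i r IH].
  by under eq_fun do rewrite big_nil; exact: bounded_measurable_cst.
by under eq_fun do rewrite big_cons; exact: bounded_measurableD.
Qed.

Lemma bounded_measurable_cvg (f_ : nat -> T -> R) f (b : nat -> R) (M : R) :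
  (forall m, bounded_measurable (f_ m)) -> (forall m x, `|f_ m x| <= b m) ->
  b m @[m --> \oo] --> M -> (forall x, f_ m x @[m --> \oo] --> f x) ->
  bounded_measurable f.
Proof.
move=> bf_ f_b bM f_f; split.
  by apply: (measurable_fun_cvg (fun m => (bf_ m).1)) => x _; exact: f_f.
by exists M => x; apply: (ler_cvg_to (cvg_norm (f_f x)) bM); exact: nearW.
Qed.

End BoundedMeasurable.

Lemma bounded_measurable_comp (R : realType) (d d' : measure_display) (T : measurableType d)
    (T' : measurableType d') (phi : T' -> T) (f : T -> R) :
  measurable_fun setT phi -> bounded_measurable f -> bounded_measurable (f \o phi).
Proof. by move=> mphi [mf [M fM]]; split; [exact: measurableT_comp|exists M => x /=]. Qed.

Definition diagonal (T : Type) (x : T) : T * T := (x, x).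

Lemma measurable_diagonal (d : measure_display) (T : measurableType d) :
  measurable_fun setT (@diagonal T).
Proof. exact: measurable_fun_pair. Qed.

HB.instance Definition _ (d : measure_display) (T : measurableType d) :=
  isMeasurableFun.Build _ _ T (T * T)%type (@diagonal T) (@measurable_diagonal d T).

#[local] Hint Resolve bounded_measurable_cst bounded_measurableD bounded_measurableN bounded_measurableM
  bounded_measurableX bounded_measurable_expR bounded_measurable_sum : core.

Section BoundedExpectation.
Variables (R : realType) (d : measure_display) (T : measurableType d).
Variable P : probability T R.
Implicit Types f g : T -> R.

Lemma bounded_measurable_integrable f :
  bounded_measurable f -> P.-integrable setT (EFin \o f).
Proof.
move=> [mf [M fM]]; apply: measurable_bounded_integrable => //.
  by apply: (le_lt_trans (probability_le1 _ _)) => //; exact: ltry.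
exists M; split; first exact: num_real.
by move=> y My x _; rewrite /= (le_trans (fM x)) // ltW.
Qed.

#[local] Hint Resolve bounded_measurable_integrable : core.

Lemma EFin_bounded_Rintegral f :
  bounded_measurable f -> (\int[P]_x f x)%:E = (\int[P]_x (f x)%:E)%E.
Proof.
move=> bf; rewrite fineK //; apply: integrable_fin_num => //.
exact: bounded_measurable_integrable.
Qed.

Lemma Rintegral_prob_cst (a : R) : \int[P]_x a = a.
Proof.
rewrite Rintegral_cst // -[RHS]mulr1; congr (_ * _).
exact: (congr1 fine (probability_setT P)).
Qed.

Lemma bounded_RintegralD f g : bounded_measurable f -> bounded_measurable g ->
  \int[P]_x (f x + g x) = \int[P]_x f x + \int[P]_x g x.
Proof. by move=> bf bg; apply: RintegralD; auto. Qed.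

Lemma bounded_RintegralZ (a : R) f : bounded_measurable f ->
  \int[P]_x (a * f x) = a * \int[P]_x f x.
Proof. by move=> bf; apply: RintegralZl; auto. Qed.

Lemma bounded_le_Rintegral f g : bounded_measurable f -> bounded_measurable g ->
  (forall x, f x <= g x) -> \int[P]_x f x <= \int[P]_x g x.
Proof. by move=> bf bg fg; apply: le_Rintegral; auto. Qed.

Lemma bounded_Rintegral_sum (I : Type) (r : seq I) (f : I -> T -> R) :
  (forall i, bounded_measurable (f i)) ->
  \int[P]_x (\sum_(i <- r) f i x) = \sum_(i <- r) \int[P]_x f i x.
Proof.
move=> bf; elim: r => [|i r IH].
  rewrite big_nil; under eq_fun do rewrite big_nil; exact: Rintegral_prob_cst.
rewrite big_cons -IH; under eq_fun do rewrite big_cons.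
by rewrite bounded_RintegralD; auto.
Qed.

Lemma cvg_bounded_Rintegral (f_ : nat -> T -> R) f (b : nat -> R) (M : R) :
  (forall m, bounded_measurable (f_ m)) -> (forall m x, `|f_ m x| <= b m) ->
  b m @[m --> \oo] --> M -> (forall x, f_ m x @[m --> \oo] --> f x) ->
  \int[P]_x f_ m x @[m --> \oo] --> \int[P]_x f x.
Proof.
move=> bf_ f_b bM f_f; have bf := bounded_measurable_cvg bf_ f_b bM f_f.
have [B [_ /(_ (B + 1))]] := cvg_seq_bounded (cvgP _ bM).
rewrite ltrDl ltr01 => /(_ isT) bB.
have [|||||_ _] := @dominated_convergence _ T R P setT measurableT
    (fun m => EFin \o f_ m) (EFin \o f) (cst (B + 1)%:E).
- by move=> m; apply/measurable_EFinP; exact: (bf_ m).1.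
- by apply/measurable_EFinP; exact: bf.1.
- by apply: aeW => x _; apply: cvg_EFin; [exact: nearW|exact: f_f].
- exact: (bounded_measurable_integrable (bounded_measurable_cst T (B + 1))).
- apply: aeW => x m _; rewrite lee_fin (le_trans (f_b m x)) //.
  exact: le_trans (ler_norm _) (bB m I).
by rewrite -[X in _ --> X]EFin_bounded_Rintegral // => /fine_cvg.
Qed.

Lemma sqr_Rintegral_le f : bounded_measurable f ->
  (\int[P]_x f x) ^+ 2 <= \int[P]_x (f x ^+ 2).
Proof.
move=> bf; set e := \int[P]_x f x.
have : 0 <= \int[P]_x (f x ^+ 2 + (- (2 * e) * f x + e ^+ 2)).
  by apply: Rintegral_ge0 => x _; rewrite (_ : _ + _ = (f x - e) ^+ 2) ?sqr_ge0 //; ring.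
rewrite !bounded_RintegralD ?bounded_RintegralZ ?Rintegral_prob_cst; auto.
by rewrite -/e; move: (\int[P]_x _) => I; nra.
Qed.

End BoundedExpectation.

#[local] Hint Resolve bounded_measurable_integrable : core.

Lemma bounded_Rintegral_distribution (R : realType) (d d' : measure_display)
    (T : measurableType d) (S : measurableType d') (P : probability T R)
    (phi : {mfun T >-> S}) (f : S -> R) :
  bounded_measurable f -> \int[distribution P phi]_y f y = \int[P]_x f (phi x).
Proof.
move=> bf; rewrite /Rintegral integral_distribution //.
  by apply/measurable_EFinP; exact: bf.1.
exact: bounded_measurable_integrable (bounded_measurable_comp _ bf).
Qed.

Section Hoeffding.
Variable R : realType.

Lemma is_derive_ge0_nondecreasing (f f' : R -> R) (a x : R) :
  (forall y : R, is_derive y 1 f (f' y)) -> (forall y, a <= y -> 0 <= f' y) ->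
  a <= x -> f a <= f x.
Proof.
move=> df f'0 ax.
have [c + fE] := MVT_segment ax (fun y _ => df y)
  (derivable_within_continuous (fun y _ => @ex_derive _ _ _ _ _ _ _ (df y))).
rewrite in_itv /= => /andP[ac _].
by rewrite -subr_ge0 fE mulr_ge0 ?subr_ge0 // f'0.
Qed.

(* With [u] the tilted probability [p e^x / (1 - p + p e^x)], the log-moment generating
   function of a Bernoulli variable has second derivative [u (1 - u) <= 1 / 4]. *)
Lemma bernoulli_mgf_le_ge0 (p h : R) : 0 <= p <= 1 -> 0 <= h ->
  1 - p + p * expR h <= expR (p * h + h ^+ 2 / 8).
Proof.
move=> /andP[p0 p1] h0; pose q (x : R) : R := 1 - p + p * expR x.
have q0 x : 0 < q x.
  rewrite /q; have [->|p_neq0] := eqVneq p 0; first by rewrite mul0r addr0 subr0.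
  by rewrite ltr_wpDl ?subr_ge0 // mulr_gt0 ?expR_gt0 // lt_def p_neq0.
have q_neq0 x : q x != 0 by rewrite gt_eqF.
have dq (x : R) : is_derive x 1 q (p * expR x).
  by rewrite /q; apply: is_derive_eq; rewrite /GRing.scale /=; ring.
pose D (x : R) : R := p + x / 4 - p * expR x / q x.
have dD (x : R) : is_derive x 1 D ((p * expR x / q x - 2^-1) ^+ 2).
  have dqV : is_derive x 1 (fun y => (q y)^-1) _ := is_deriveV (q_neq0 x) (dq x).
  rewrite /D; apply: is_derive_eq; rewrite /GRing.scale /=; field.
  exact: q_neq0.
have D0 x : 0 <= x -> 0 <= D x.
  move=> /(is_derive_ge0_nondecreasing dD (fun _ _ => sqr_ge0 _)).
  by rewrite {1}/D /q expR0 mulr1 subrK mul0r addr0 divr1 subrr.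
pose F (x : R) : R := p * x + x ^+ 2 / 8 - ln (q x).
have dF (x : R) : is_derive x 1 F (D x).
  have dlnq : is_derive x 1 (fun y => ln (q y)) _ := is_derive1_comp (is_derive1_ln (q0 x)) (dq x).
  rewrite /F; apply: is_derive_eq; rewrite /D /GRing.scale /=; field.
  exact: q_neq0.
have := is_derive_ge0_nondecreasing dF D0 h0.
rewrite /F {1}/q expR0 mulr1 subrK ln1 mulr0 expr0n mul0r subr0 addr0 subr_ge0 => lnq.
by rewrite -[leLHS]lnK ?posrE ?q0 // ler_expR.
Qed.

Lemma bernoulli_mgf_le (p h : R) : 0 <= p <= 1 ->
  1 - p + p * expR h <= expR (p * h + h ^+ 2 / 8).
Proof.
move=> p01; have [|/ltW h0] := leP 0 h; first exact: bernoulli_mgf_le_ge0.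
have p01' : 0 <= 1 - p <= 1 by lra.
have := bernoulli_mgf_le_ge0 p01' (_ : 0 <= - h); rewrite oppr_ge0 => /(_ h0).
rewrite -(ler_pM2l (expR_gt0 h)) -expRD mulrDr mulrCA -expRD subrr expR0 mulr1.
by congr (_ <= expR _); ring.
Qed.

Lemma expR_chord (a b t : R) : 0 <= t <= 1 ->
  expR (t * a + (1 - t) * b) <= t * expR a + (1 - t) * expR b.
Proof. by move=> /andP[t0 t1]; have := convex_expR (Itv01 t0 t1) a b; rewrite !convRE. Qed.

Variables (d : measure_display) (T : measurableType d) (P : probability T R).

Lemma hoeffding_mgf_le (f : T -> R) (a b l : R) : measurable_fun setT f -> a < b ->
  (forall x, a <= f x <= b) ->
  \int[P]_x expR (l * f x) <= expR (l * \int[P]_x f x + l ^+ 2 * (b - a) ^+ 2 / 8).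
Proof.
move=> mf ab fab; have ba0 : 0 < b - a by rewrite subr_gt0.
have bf : bounded_measurable f.
  split=> //; exists (`|a| + `|b|) => x; have /andP[ax xb] := fab x.
  have := ler_norm b; have := ler_norm (- a); have := normr_ge0 a; have := normr_ge0 b.
  by rewrite normrN ler_norml => *; lra.
pose t x := (b - a)^-1 * (f x + - a).
have bt : bounded_measurable t by rewrite /t; auto.
have t01 x : 0 <= t x <= 1.
  have /andP[ax xb] := fab x; rewrite /t mulrC divr_ge0 ?(ltW ba0) ?subr_ge0 //=.
  by rewrite ler_pdivrMr // mul1r lerD2r.
pose p := \int[P]_x t x.
have p01 : 0 <= p <= 1.
  apply/andP; split; first by apply: Rintegral_ge0 => x _; case/andP: (t01 x).
  rewrite -[leRHS](Rintegral_prob_cst P); apply: bounded_le_Rintegral => //.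
  by move=> x; case/andP: (t01 x).
have pE : \int[P]_x f x = a + p * (b - a).
  rewrite /p /t bounded_RintegralZ ?bounded_RintegralD ?Rintegral_prob_cst; auto.
  by field; rewrite gt_eqF.
apply: (@le_trans _ _ (\int[P]_x (expR (l * a) * (1 + (expR (l * (b - a)) - 1) * t x)))).
  apply: bounded_le_Rintegral => [||x]; [by auto 6..|].
  have -> : l * f x = t x * (l * b) + (1 - t x) * (l * a) by rewrite /t; field; rewrite gt_eqF.
  rewrite (_ : _ * (1 + _) = t x * expR (l * b) + (1 - t x) * expR (l * a)); last first.
    by rewrite (_ : l * b = l * a + l * (b - a)) ?expRD; ring.
  exact: expR_chord.
rewrite bounded_RintegralZ ?bounded_RintegralD ?(bounded_RintegralZ P _ bt); auto.
rewrite Rintegral_prob_cst -/p pE.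
rewrite (_ : l * _ + _ = l * a + (p * (l * (b - a)) + (l * (b - a)) ^+ 2 / 8)); last by field.
rewrite expRD ler_pM2l ?expR_gt0 // (_ : 1 + _ = 1 - p + p * expR (l * (b - a))); last by ring.
exact: bernoulli_mgf_le.
Qed.

Lemma oscillation_le_range (f : T -> R) (c : R) : (exists M, forall x, `|f x| <= M) ->
  (forall x y, f x - f y <= c) -> exists a, forall x, a <= f x <= a + c.
Proof.
move=> [M fM] fc; exists (inf (range f)) => x; apply/andP; split.
  apply: ge_inf; last by exists x.
  by exists (- M) => _ [y _ <-]; have := fM y; rewrite ler_norml => /andP[].
rewrite -lerBlDr; apply: lb_le_inf; first by exists (f x), x.
by move=> _ [y _ <-]; rewrite lerBlDr -lerBlDl fc.
Qed.

End Hoeffding.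

(** * McDiarmid's inequality *)

Lemma bounded_measurable_Rintegral (R : realType) (d d' : measure_display)
    (T : measurableType d) (Z : measurableType d') (P : probability T R) (F : Z * T -> R) :
  bounded_measurable F -> bounded_measurable (fun z => \int[P]_y F (z, y)).
Proof.
move=> bF; have [_ [M FM]] := bF.
have bFz z : bounded_measurable (fun y => F (z, y)).
  exact: (bounded_measurable_comp (@measurable_pair1 _ _ _ _ z)).
split; last first.
  exists M => z; apply: (le_trans (le_normr_Rintegral measurableT _)).
    exact: bounded_measurable_integrable.
  rewrite -[leRHS](Rintegral_prob_cst P); apply: bounded_le_Rintegral => //.
  by split; [apply: measurableT_comp => //; exact: (bFz z).1|exists M => y; rewrite normr_id].
have mI : measurable_fun setT (fubini_F P (fun z => (F z + M)%:E)).
  apply: measurable_fun_fubini_tonelli_F.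
    by apply/measurable_EFinP/measurable_funD => //; exact: bF.1.
  by move=> z; rewrite lee_fin -lerBlDr sub0r; have := FM z; rewrite ler_norml => /andP[].
rewrite (_ : (fun z => _) = fun z => fine (fubini_F P (fun z => (F z + M)%:E) z) - M).
  apply: measurable_funB => //.
  exact: (measurableT_comp (@fine_measurable R setT measurableT) mI).
apply/funext => z; rewrite -[fine _]/(\int[P]_y (F (z, y) + M)).
by rewrite bounded_RintegralD ?Rintegral_prob_cst ?addrK.
Qed.

Section IidMean.
Variables (R : realType) (d : measure_display) (T : measurableType d) (P : probability T R).
Implicit Types (F : seq T -> R) (xs : seq T).

Definition bounded_measurable_seq F : Prop :=
  forall m, bounded_measurable (fun xs : m.-tuple T => F xs).

(* The expectation of [F] at [m] independent draws from [P] put in front of [xs]. *)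
Fixpoint iid_mean (m : nat) F xs : R :=
  if m is m'.+1 then \int[P]_y iid_mean m' F (y :: xs) else F xs.

Definition bounded_differences F (c : R) : Prop :=
  forall s y y' xs, F (s ++ y :: xs) - F (s ++ y' :: xs) <= c.

Lemma iid_meanSr m F xs :
  iid_mean m.+1 F xs = iid_mean m (fun ys => \int[P]_y F (y :: ys)) xs.
Proof.
by elim: m xs => // m IH xs; congr Rintegral; apply/funext => y; exact: IH.
Qed.

Lemma bounded_measurable_cons F xs :
  bounded_measurable_seq F -> bounded_measurable (fun y => F (y :: xs)).
Proof.
move=> /(_ (size xs).+1); apply: bounded_measurable_comp (fun y => [tuple of y :: in_tuple xs]) _ _.
by apply: measurable_cons => //; exact: measurable_cst.
Qed.

Lemma bounded_measurable_seq_Rintegral F : bounded_measurable_seq F ->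
  bounded_measurable_seq (fun xs => \int[P]_y F (y :: xs)).
Proof.
move=> bF m; pose G (z : m.-tuple T * T) := F [tuple of z.2 :: z.1].
apply: (@bounded_measurable_Rintegral _ _ _ _ _ _ G).
apply: bounded_measurable_comp (bF m.+1).
exact: measurable_cons.
Qed.

Lemma bounded_measurable_iid_mean m F :
  bounded_measurable_seq F -> bounded_measurable_seq (iid_mean m F).
Proof. by move=> bF; elim: m => //= m; exact: bounded_measurable_seq_Rintegral. Qed.

Lemma bounded_measurable_seq_expRM F (l : R) : bounded_measurable_seq F ->
  bounded_measurable_seq (fun xs => expR (l * F xs)).
Proof. by move=> bF m; have := bF m; auto. Qed.

Lemma bounded_differences_iid_mean m F c : bounded_measurable_seq F ->
  bounded_differences F c -> bounded_differences (iid_mean m F) c.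
Proof.
move=> bF dF; elim: m => //= m IH s y y' xs.
have bm ys := bounded_measurable_cons ys (bounded_measurable_iid_mean m bF).
rewrite lerBlDr -[c](Rintegral_prob_cst P) -bounded_RintegralD; auto.
by apply: bounded_le_Rintegral; auto => z; rewrite -lerBlDr; exact: (IH (z :: s)).
Qed.

Lemma sqr_iid_mean_le m F v xs : bounded_measurable_seq F ->
  (forall ys, \int[P]_y (F (y :: ys) ^+ 2) <= F ys ^+ 2 + v) ->
  iid_mean m F xs ^+ 2 <= F xs ^+ 2 + m%:R * v.
Proof.
move=> bF Fv; elim: m xs => [|m IH] xs; first by rewrite mul0r addr0.
have bm := bounded_measurable_cons xs (bounded_measurable_iid_mean m bF).
apply: (le_trans (sqr_Rintegral_le P bm)).
rewrite -natr1 mulrDl mul1r (addrC (_ * v)) addrA -lerBlDr.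
apply: le_trans (Fv xs); rewrite lerBlDr -[m%:R * v](Rintegral_prob_cst P).
have bFxs := bounded_measurable_cons xs bF.
by rewrite -bounded_RintegralD; auto; apply: bounded_le_Rintegral; auto.
Qed.

(* Azuma's argument: each draw moves the conditional mean by at most [c]. *)
Lemma iid_mean_expR_le m F c l xs : 0 < c -> bounded_measurable_seq F ->
  bounded_differences F c ->
  iid_mean m (fun ys => expR (l * F ys)) xs
    <= expR (l * iid_mean m F xs + m%:R * (l ^+ 2 * c ^+ 2 / 8)).
Proof.
move=> c0 bF dF; elim: m xs => [|m IH] xs; first by rewrite mul0r addr0.
pose g y := iid_mean m F (y :: xs); pose v := l ^+ 2 * c ^+ 2 / 8.
have bg : bounded_measurable g := bounded_measurable_cons xs (bounded_measurable_iid_mean m bF).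
apply: (@le_trans _ _ (\int[P]_y (expR (m%:R * v) * expR (l * g y)))).
  apply: bounded_le_Rintegral; [|by auto|by move=> y; rewrite -expRD addrC; exact: IH].
  exact/bounded_measurable_cons/bounded_measurable_iid_mean/bounded_measurable_seq_expRM.
have [a ga] : exists a, forall y, a <= g y <= a + c.
  apply: (oscillation_le_range bg.2) => y y'.
  exact: (bounded_differences_iid_mean m bF dF [::]).
have := hoeffding_mgf_le P l bg.1 (_ : a < a + c) ga; rewrite ltrDl => /(_ c0).
rewrite [a + c]addrC addrK -/v => hoeff.
rewrite bounded_RintegralZ; last by auto.
rewrite (_ : l * _ + _ = m%:R * v + (l * \int[P]_y g y + v)); last first.
  by rewrite -natr1 /= -/g; ring.
by rewrite [leRHS]expRD ler_pM2l ?expR_gt0.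
Qed.

End IidMean.

Section Independence.
Variables (R : realType) (dO : measure_display) (Omega : measurableType dO).
Variable Pr : probability Omega R.
Variables (d : measure_display) (T : measurableType d) (P : probability T R).

Lemma Rintegral_independent_pair (dZ : measure_display) (Z : measurableType dZ)
    (phi : Omega -> Z) (Y : Omega -> T) (F : Z * T -> R) :
  measurable_fun setT phi -> measurable_fun setT Y ->
  (forall A B, measurable A -> measurable B ->
    Pr (phi @^-1` A `&` Y @^-1` B) = (Pr (phi @^-1` A) * P B)%E) ->
  bounded_measurable F ->
  \int[Pr]_w F (phi w, Y w) = \int[Pr]_w \int[P]_y F (phi w, y).
Proof.
move=> mphi mY ind bF; pose psi w := (phi w, Y w).
have mpsi : measurable_fun setT psi by exact: measurable_fun_pair.
pose mfun_phi : {mfun Omega >-> Z} := HB.pack phi (isMeasurableFun.Build _ _ _ _ phi mphi).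
pose mfun_psi : {mfun Omega >-> (Z * T)%type} :=
  HB.pack psi (isMeasurableFun.Build _ _ _ _ psi mpsi).
have lawE A : measurable A ->
    (distribution Pr mfun_phi \x P)%E A = distribution Pr mfun_psi A.
  by apply: product_measure_unique => B C mB mC; exact: ind.
have intF : (distribution Pr mfun_phi \x P)%E.-integrable setT (EFin \o F).
  exact: bounded_measurable_integrable.
transitivity (fine (\int[distribution Pr mfun_psi]_z (F z)%:E)%E).
  rewrite integral_distribution //; first by apply/measurable_EFinP; exact: bF.1.
  by apply: bounded_measurable_integrable; exact: bounded_measurable_comp bF.
rewrite -(eq_measure_integral _ (fun A mA _ => lawE A mA)) -integral12_prod_meas1 //.
rewrite integral_distribution /=.
- congr fine; apply: eq_integral => w _; rewrite EFin_bounded_Rintegral //.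
  exact: bounded_measurable_comp (@measurable_pair1 _ _ _ _ (phi w)) bF.
- exact: measurable_fubini_F intF.
rewrite (_ : _ \o _ = EFin \o (fun w => \int[P]_y F (phi w, y))).
  apply: bounded_measurable_integrable.
  exact: bounded_measurable_comp mphi (bounded_measurable_Rintegral P bF).
apply/funext => w /=; rewrite EFin_bounded_Rintegral //.
exact: bounded_measurable_comp (@measurable_pair1 _ _ _ _ (phi w)) bF.
Qed.

Variables (n : nat) (X : 'I_n -> Omega -> T).

Definition subsample m (s : m.-tuple 'I_n) (w : Omega) : m.-tuple T := map_tuple (X^~ w) s.

Definition boxes m (s : m.-tuple 'I_n) : set (set (m.-tuple T)) :=
  [set A | exists2 B : 'I_n -> set T, (forall j, measurable (B j)) &
    A = [set t | forall k, B (tnth s k) (tnth t k)]].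

Lemma boxes_measurable m (s : m.-tuple 'I_n) : boxes s `<=` measurable.
Proof.
move=> _ [B mB ->].
rewrite (_ : [set t | _] = \bigcap_(k in setT) ((@tnth m T)^~ k @^-1` B (tnth s k))).
  apply: fin_bigcap_measurable => // k _.
  by rewrite -[X in measurable X]setTI; exact: measurable_tnth.
by apply/seteqP; split=> [t Bt k _|t Bt k]; [exact: Bt|exact: (Bt k)].
Qed.

Lemma boxes_setI m (s : m.-tuple 'I_n) : setI_closed (boxes s).
Proof.
move=> _ _ [A mA ->] [B mB ->]; exists (fun j => A j `&` B j).
  by move=> j; exact: measurableI.
by apply/seteqP; split=> [t [tA tB] k|t tAB]; [split|split=> k; case: (tAB k)].
Qed.

Lemma boxes_setT m (s : m.-tuple 'I_n) : boxes s setT.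
Proof. by exists (fun=> setT) => //; apply/seteqP; split. Qed.

Lemma measurable_gen_boxes m (s : m.-tuple 'I_n) (A : set (m.-tuple T)) :
  uniq s -> measurable A -> <<s boxes s >> A.
Proof.
move=> us; apply: smallest_sub; first exact: smallest_sigma_algebra.
rewrite -bigcup_seq => _ [k _ [B mB <-]]; apply: sub_sigma_algebra.
exists (fun j => if j == tnth s k then B else setT); first by move=> j; case: ifP.
rewrite setTI; apply/seteqP; split=> [t tB l|t /(_ k)] /=; last by rewrite eqxx.
by rewrite (inj_eq (tuple_uniqP _ us)); case: eqP => // ->.
Qed.

Hypothesis X_measurable : forall i, measurable_fun setT (X i).
Hypothesis X_independent : mutually_independent Pr X.
Hypothesis X_law : identically_distributed Pr P X.

Lemma measurable_subsample m (s : m.-tuple 'I_n) : measurable_fun setT (subsample s).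
Proof.
apply/measurable_fun_tnthP => k; rewrite (_ : _ \o _ = X (tnth s k)) //.
by apply/funext => w /=; rewrite tnth_map.
Qed.

Lemma box_independent m (s : m.-tuple 'I_n) i A B : i \notin s -> boxes s A ->
  measurable B -> Pr (subsample s @^-1` A `&` X i @^-1` B) = (Pr (subsample s @^-1` A) * P B)%E.
Proof.
move=> si [C mC ->] mB; rewrite -(X_law i mB).
pose J : {set 'I_n} := [set j in s]%SET.
pose C' j := if j == i then B else C j.
have C'i : C' i = B by rewrite /C' eqxx.
have C'E j : j \in J -> C' j = C j.
  by rewrite inE /C'; case: eqP => // ->; rewrite (negPf si).
have mC' j : measurable (C' j) by rewrite /C'; case: ifP.
have -> : subsample s @^-1` [set t | forall k, C (tnth s k) (tnth t k)] =
    \bigcap_(j in [set j | j \in J]) (X j @^-1` C j).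
  apply/seteqP; split=> w wC => [j /=|k]; last first.
    by rewrite tnth_map; apply: (wC (tnth s k)); rewrite /= inE mem_tnth.
  by rewrite inE => /tnthP[k ->]; have := wC k; rewrite tnth_map.
have iJ : i \notin J by rewrite inE.
have := X_independent (i |: J)%SET mC'; rewrite big_setU1 //= C'i.
rewrite (eq_bigr (fun j => Pr (X j @^-1` C j))) => [|j /C'E -> //].
rewrite -(X_independent J mC) muleC => <-; congr (Pr _).
apply/seteqP; split=> [w [wC wB] j|w wC].
  rewrite /= !inE => /orP[/eqP ->|js]; first by rewrite C'i.
  by rewrite C'E ?inE //; apply: wC; rewrite /= inE.
split=> [j /= jJ|]; last by rewrite -C'i; apply: wC; rewrite /= setU11.
by rewrite -C'E //; apply: wC; rewrite /= in_setU1 jJ orbT.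
Qed.

Lemma subsample_independent m (s : m.-tuple 'I_n) i A B : i \notin s -> uniq s ->
  measurable A -> measurable B ->
  Pr (subsample s @^-1` A `&` X i @^-1` B) = (Pr (subsample s @^-1` A) * P B)%E.
Proof.
move=> si us mA mB.
pose phi : {mfun Omega >-> m.-tuple T} :=
  HB.pack (subsample s) (isMeasurableFun.Build _ _ _ _ (subsample s) (measurable_subsample s)).
have mD : measurable (X i @^-1` B) by rewrite -[X in measurable X]setTI; exact: X_measurable.
pose r : {nonneg R} := NngNum (fine_ge0 (measure_ge0 P B)).
have rE : (r%:num%:E = P B)%E by rewrite /= fineK // fin_num_measure.
rewrite -[LHS]/(pushforward (mrestr Pr mD) phi A) muleC -rE.
rewrite -[RHS]/(mscale r (distribution Pr phi) A).
apply: (g_sigma_algebra_measure_unique (boxes s) (@boxes_measurable _ s) (fun=> setT)).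
- by move=> _; exact: boxes_setT.
- by rewrite bigcup_const //; exists 0%N.
- exact: boxes_setI.
- by move=> C bC; rewrite /= /mscale -[LHS]/(Pr (_ `&` _)) box_independent // muleC -rE.
- by move=> _; rewrite -[X in (X < _)%E]/(Pr (_ `&` _)) setTI ltey_eq fin_num_measure.
- exact: measurable_gen_boxes.
Qed.

Lemma Rintegral_sample (F : seq T -> R) (s : seq 'I_n) : bounded_measurable_seq F -> uniq s ->
  \int[Pr]_w F [seq X j w | j <- s] = iid_mean P (size s) F [::].
Proof.
elim: s F => [|i s IH] F bF; first by move=> _; rewrite /= Rintegral_prob_cst.
case/andP => si us; rewrite [size _]/= iid_meanSr -IH //; last first.
  exact: bounded_measurable_seq_Rintegral.
pose G (z : (size s).-tuple T * T) := F [tuple of z.2 :: z.1].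
apply: (@Rintegral_independent_pair _ _ (subsample (in_tuple s)) (X i) G) => //.
- exact: measurable_subsample.
- by move=> A B; exact: (@subsample_independent _ (in_tuple s)).
- by apply: bounded_measurable_comp (bF _); exact: measurable_cons.
Qed.

Lemma measurable_sample (F : seq T -> R) : bounded_measurable_seq F ->
  measurable_fun setT (fun w => F [seq X i w | i <- enum 'I_n]).
Proof.
move=> bF; have := measurable_subsample (in_tuple (enum 'I_n)).
exact: measurableT_comp (bF _).1.
Qed.

Hypothesis n_gt0 : (0 < n)%N.

Lemma mcdiarmid (F : seq T -> R) (c t : R) : bounded_measurable_seq F -> 0 < c -> 0 < t ->
  bounded_differences F c ->
  (Pr [set w | (iid_mean P n F [::] + t <= F [seq X i w | i <- enum 'I_n])%R] <=
    (expR (- (2 * t ^+ 2 / (n%:R * c ^+ 2))))%:E)%E.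
Proof.
move=> bF c0 t0 dF; pose Y w := F [seq X i w | i <- enum 'I_n].
have mY : measurable_fun setT Y := measurable_sample bF.
pose mfun_Y : {RV Pr >-> R} := HB.pack Y (isMeasurableFun.Build _ _ _ _ Y mY).
have n0 : 0 < n%:R :> R by rewrite ltr0n.
pose l := 4 * t / (n%:R * c ^+ 2); pose m := iid_mean P n F [::].
have l0 : 0 < l by rewrite divr_gt0 ?mulr_gt0 ?exprn_gt0.
apply: (le_trans (chernoff mfun_Y (m + t) l0)).
rewrite /mmt_gen_fun unlock.
have bE := bounded_measurable_seq_expRM l bF.
have -> : (\int[Pr]_w ((expR \o l \o* mfun_Y) w)%:E)%E =
    (iid_mean P n (fun xs => expR (l * F xs)) [::])%:E.
  rewrite -[n in RHS]size_enum_ord -Rintegral_sample ?enum_uniq // EFin_bounded_Rintegral.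
    by apply: eq_integral => w _ /=; rewrite mulrC.
  exact: bounded_measurable_comp (measurable_subsample (in_tuple (enum 'I_n))) (bE _).
rewrite -EFinM lee_fin -ler_pdivlMr ?expR_gt0 // -expRN opprK -expRD.
apply: (le_trans (iid_mean_expR_le P n l [::] c0 bF dF)).
rewrite ler_expR -/m (_ : l * m + _ = - (2 * t ^+ 2 / (n%:R * c ^+ 2)) + l * (m + t)) // /l.
by field; rewrite !gt_eqF.
Qed.

End Independence.

(** * Mean embeddings *)

Section MeanKernel.
Variables (R : realType) (d : measure_display) (S : measurableType d) (P : probability S R).
Variable K : S -> S -> R.

Definition mean_embedding (s : S) : R := \int[P]_y K y s.

(* The Gram kernel of the feature vectors of [K] together with the mean embedding of [P],
   which has the index [None]. *)
Definition mean_kernel (s t : option S) : R :=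
  match s, t with
  | Some x, Some y => K x y
  | Some x, None | None, Some x => mean_embedding x
  | None, None => \int[P]_y mean_embedding y
  end.

Definition embedding_variance : R := \int[P]_y K y y - mean_kernel None None.

Hypothesis psdK : psd_kernel K.
Hypothesis K_le1 : forall s, K s s <= 1.
Hypothesis K_measurable : measurable_fun setT (fun p : S * S => K p.1 p.2).

Implicit Types (c : seq (R * option S)) (w : seq (R * S)).

Lemma bounded_measurable_kernel : bounded_measurable (fun p : S * S => K p.1 p.2).
Proof.
split=> //; exists 1 => -[s t] /=.
have := comb_eval_le_norm psdK [:: (1, s)] t.
rewrite comb_norm_seq1 /comb_eval big_seq1 normr1 !mul1r => /le_trans; apply.
by rewrite -[leRHS]mulr1 -[1]sqrtr1 ler_pM ?ler_wsqrtr ?sqrtr_ge0.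
Qed.

Lemma bounded_measurable_kernel_diag : bounded_measurable (fun y => K y y).
Proof.
exact: bounded_measurable_comp (@measurable_diagonal _ S) bounded_measurable_kernel.
Qed.

Lemma bounded_measurable_kernel_section s : bounded_measurable (fun y => K y s).
Proof. exact: bounded_measurable_comp (@measurable_pair2 _ _ _ _ s) bounded_measurable_kernel. Qed.

Lemma bounded_measurable_mean_embedding : bounded_measurable mean_embedding.
Proof.
apply: (@bounded_measurable_Rintegral _ _ _ _ _ P (fun p => K p.2 p.1)).
exact: bounded_measurable_comp (measurable_fun_pair measurable_snd measurable_fst) bounded_measurable_kernel.
Qed.

Lemma mean_kernelC s t : mean_kernel s t = mean_kernel t s.
Proof. by case: s t => [s|] [t|] //=; exact: psdK.1. Qed.

Lemma bounded_measurable_mean_kernel t : bounded_measurable (fun y => mean_kernel (Some y) t).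
Proof.
by case: t => [t|]; [exact: bounded_measurable_kernel_section|exact: bounded_measurable_mean_embedding].
Qed.

Lemma Rintegral_mean_kernel t : \int[P]_y mean_kernel (Some y) t = mean_kernel None t.
Proof. by case: t. Qed.

Lemma bounded_measurable_comb_eval_mean c :
  bounded_measurable (fun y => comb_eval mean_kernel c (Some y)).
Proof.
apply: bounded_measurable_sum => p; apply: bounded_measurableM => //.
by under eq_fun do rewrite mean_kernelC; exact: bounded_measurable_mean_kernel.
Qed.

Lemma Rintegral_comb_eval_mean c :
  \int[P]_y comb_eval mean_kernel c (Some y) = comb_eval mean_kernel c None.
Proof.
have bm := bounded_measurable_mean_kernel.
rewrite (_ : (fun y => _) = fun y => \sum_(p <- c) p.1 * mean_kernel (Some y) p.2); last first.
  by apply/funext => y; apply: eq_bigr => p _; rewrite mean_kernelC.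
rewrite bounded_Rintegral_sum => [|p]; last by auto.
by apply: eq_bigr => p _; rewrite bounded_RintegralZ // Rintegral_mean_kernel mean_kernelC.
Qed.

(* Replacing the mean embedding by the feature vector of a random point costs its variance. *)
Lemma Rintegral_comb_sqnorm_cons a c :
  \int[P]_y comb_sqnorm mean_kernel ((a, Some y) :: c) =
  comb_sqnorm mean_kernel ((a, None) :: c) + a ^+ 2 * embedding_variance.
Proof.
have bd := bounded_measurable_kernel_diag; have be := bounded_measurable_comb_eval_mean c.
under eq_fun do rewrite (comb_sqnorm_cons mean_kernelC) /=.
rewrite !bounded_RintegralD; auto.
rewrite !bounded_RintegralZ // Rintegral_prob_cst Rintegral_comb_eval_mean.
by rewrite (comb_sqnorm_cons mean_kernelC) /embedding_variance; ring.
Qed.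

Lemma bounded_measurable_comb_sqnorm_cons a c :
  bounded_measurable (fun y => comb_sqnorm mean_kernel ((a, Some y) :: c)).
Proof.
have bd := bounded_measurable_kernel_diag; have be := bounded_measurable_comb_eval_mean c.
by under eq_fun do rewrite (comb_sqnorm_cons mean_kernelC) /=; auto 6.
Qed.

Lemma comb_sqnorm_mean_variance_ge0 (r : seq R) w :
  0 <= comb_sqnorm mean_kernel ([seq (a, None) | a <- r] ++ comb_map Some w)
       + (\sum_(a <- r) a ^+ 2) * embedding_variance.
Proof.
elim: r w => [|a r IH] w.
  by rewrite big_nil mul0r addr0 comb_sqnorm_map; exact: psdK.2.
pose c := [seq (a, None) | a <- r] ++ comb_map Some w.
pose v := (\sum_(a <- r) a ^+ 2) * embedding_variance.
have c_ge0 y : 0 <= comb_sqnorm mean_kernel ((a, Some y) :: c) + v.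
  rewrite (_ : comb_sqnorm _ _ = comb_sqnorm mean_kernel
    ([seq (a, None) | a <- r] ++ comb_map Some ((a, y) :: w))) ?IH //.
  apply: (eq_comb_sqnorm mean_kernelC) => s.
  by rewrite comb_eval_cons !comb_eval_cat comb_eval_cons addrCA.
have : 0 <= \int[P]_y (comb_sqnorm mean_kernel ((a, Some y) :: c) + v).
  by apply: Rintegral_ge0 => y _; exact: c_ge0.
have bc := bounded_measurable_comb_sqnorm_cons a c.
rewrite bounded_RintegralD // Rintegral_prob_cst Rintegral_comb_sqnorm_cons big_cons.
by rewrite mulrDl addrA.
Qed.

Lemma comb_eval_mean_split c : exists (a : R) w, forall t,
  comb_eval mean_kernel c t =
  a * mean_kernel None t + comb_eval mean_kernel (comb_map Some w) t.
Proof.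
elim: c => [|[b s] c [a [w cE]]].
  by exists 0, [::] => t; rewrite mul0r add0r.
case: s => [s|]; last by exists (b + a), w => t; rewrite comb_eval_cons cE /= mulrDl addrA.
by exists a, ((b, s) :: w) => t; rewrite !comb_eval_cons cE /= addrCA.
Qed.

(* The mean embedding is the limit of empirical means: splitting its coefficient [a] into
   [N] equal parts, each replaced by an independent sample, costs only [a ^ 2 / N]. *)
Lemma psd_mean_kernel : psd_kernel mean_kernel.
Proof.
split=> [|c]; first exact: mean_kernelC.
have [a [w cE]] := comb_eval_mean_split c.
have c_ge0 N : 0 <= comb_sqnorm mean_kernel c + a ^+ 2 * embedding_variance * N.+1%:R^-1.
  have N0 : N.+1%:R != 0 :> R by rewrite pnatr_eq0.
  have := comb_sqnorm_mean_variance_ge0 (nseq N.+1 (a / N.+1%:R)) w.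
  rewrite big_nseq iter_addr_0.
  rewrite (_ : _ *+ _ * _ = a ^+ 2 * embedding_variance * N.+1%:R^-1); last by field.
  congr (_ <= _ + _); apply: (eq_comb_sqnorm mean_kernelC) => t.
  rewrite comb_eval_cat cE; congr (_ + _).
  by rewrite /comb_eval big_map big_nseq iter_addr_0 /=; field.
have : comb_sqnorm mean_kernel c + a ^+ 2 * embedding_variance * harmonic N @[N --> \oo]
    --> comb_sqnorm mean_kernel c + a ^+ 2 * embedding_variance * 0.
  by apply: cvgD; [exact: cvg_cst|apply: cvgM; [exact: cvg_cst|exact: cvg_harmonic]].
rewrite mulr0 addr0 => /cvgr_to_ge; apply.
by apply: nearW => N; exact: c_ge0.
Qed.

Lemma embedding_variance_ge0 : 0 <= embedding_variance.
Proof.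
have : 0 <= \int[P]_y comb_sqnorm mean_kernel [:: (1, Some y); (-1, None)].
  by apply: Rintegral_ge0 => y _; exact: psd_mean_kernel.2.
by rewrite Rintegral_comb_sqnorm_cons /comb_sqnorm !big_cons !big_nil /= => /le_trans; apply; lra.
Qed.

Lemma Rintegral_kernel_diag_le1 : \int[P]_y K y y <= 1.
Proof.
rewrite -[leRHS](Rintegral_prob_cst P); apply: bounded_le_Rintegral => //.
exact: bounded_measurable_kernel_diag.
Qed.

Lemma embedding_variance_le1 : embedding_variance <= 1.
Proof.
rewrite lerBlDr (le_trans Rintegral_kernel_diag_le1) // lerDl.
exact: psd_kernel_diag_ge0 psd_mean_kernel None.
Qed.

Lemma mean_kernel_le1 s : mean_kernel s s <= 1.
Proof.
case: s => [s|]; first exact: K_le1.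
have := embedding_variance_ge0; rewrite subr_ge0 => /le_trans; apply.
exact: Rintegral_kernel_diag_le1.
Qed.

(* The sum of the differences between the feature vectors of [xs] and the mean embedding. *)
Definition centered_sum (xs : seq S) : seq (R * option S) :=
  flatten [seq [:: (1, Some x); (-1, None)] | x <- xs].

Definition deviation_norm (xs : seq S) : R := comb_norm mean_kernel (centered_sum xs).

Lemma comb_ip_centered_sum c xs : comb_ip mean_kernel c (centered_sum xs) =
  \sum_(x <- xs) (comb_eval mean_kernel c (Some x) - comb_eval mean_kernel c None).
Proof.
rewrite /comb_ip big_flatten big_map; apply: eq_bigr => x _.
by rewrite !big_cons big_nil /= mul1r mulN1r addr0.
Qed.

Lemma deviation_norm_pairing w xs :
  `|\sum_(x <- xs) comb_eval K w x - (size xs)%:R * \int[P]_y comb_eval K w y|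
    <= comb_norm K w * deviation_norm xs.
Proof.
have := comb_ip_le_norm psd_mean_kernel (comb_map Some w) (centered_sum xs).
rewrite comb_ip_centered_sum -Rintegral_comb_eval_mean {1}/comb_norm comb_sqnorm_map.
under eq_bigr do rewrite comb_eval_map; under eq_Rintegral do rewrite comb_eval_map.
by rewrite sumrB big_const_seq count_predT iter_addr_0 mulr_natl.
Qed.

Lemma bounded_differences_deviation_norm : bounded_differences deviation_norm 2.
Proof.
move=> s y y' xs; rewrite lerBlDl /deviation_norm.
rewrite (eq_comb_norm mean_kernelC
  (w := centered_sum (s ++ y' :: xs) ++ [:: (1, Some y); (-1, Some y')])) => [|t].
  apply: (le_trans (comb_norm_cat psd_mean_kernel _ _)); rewrite lerD2l.
  exact: (comb_norm_diff_le2 psd_mean_kernel (mean_kernel_le1 _) (mean_kernel_le1 _)).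
rewrite /centered_sum !map_cat !flatten_cat /= !(comb_eval_cat, comb_eval_cons) comb_eval_nil /=.
by ring.
Qed.

Lemma comb_sqnorm_centered_sum xs : comb_sqnorm mean_kernel (centered_sum xs) =
  \sum_(x <- xs) \sum_(y <- xs)
    (K x y - mean_embedding x - mean_embedding y + mean_kernel None None).
Proof.
rewrite comb_sqnormE comb_ip_centered_sum; apply: eq_bigr => x _.
rewrite /comb_eval !big_flatten !big_map -sumrB; apply: eq_bigr => y _.
rewrite !big_cons !big_nil /= (psdK.1 y); ring.
Qed.

Lemma bounded_measurable_seq_deviation_norm : bounded_measurable_seq deviation_norm.
Proof.
move=> m; have bme := bounded_measurable_mean_embedding.
apply: bounded_measurable_sqrt; under eq_fun do rewrite comb_sqnorm_centered_sum big_tuple.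
apply: bounded_measurable_sum => i; under eq_fun do rewrite big_tuple.
apply: bounded_measurable_sum => j; apply: bounded_measurableD => //.
have mtnth k := @measurable_tnth _ S m k.
apply: bounded_measurableD; first apply: bounded_measurableD.
- exact: bounded_measurable_comp (measurable_fun_pair (mtnth i) (mtnth j)) bounded_measurable_kernel.
- exact: bounded_measurableN (bounded_measurable_comp (mtnth i) bme).
- exact: bounded_measurableN (bounded_measurable_comp (mtnth j) bme).
Qed.

Lemma Rintegral_sqr_deviation_norm_le xs :
  \int[P]_y (deviation_norm (y :: xs) ^+ 2) <= deviation_norm xs ^+ 2 + 1.
Proof.
under eq_fun do rewrite (sqr_comb_norm psd_mean_kernel).
rewrite (Rintegral_comb_sqnorm_cons 1 ((-1, None) :: centered_sum xs)).
rewrite (sqr_comb_norm psd_mean_kernel) expr1n mul1r lerD ?embedding_variance_le1 //.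
rewrite le_eqVlt (@eq_comb_sqnorm _ _ _ mean_kernelC _ (centered_sum xs)) ?eqxx // => t.
by rewrite !comb_eval_cons /=; ring.
Qed.

Lemma iid_mean_deviation_norm_le m :
  iid_mean P m deviation_norm [::] <= Num.sqrt m%:R.
Proof.
apply: (le_trans (ler_norm _)); rewrite -sqrtr_sqr ler_wsqrtr //.
have := sqr_iid_mean_le m [::] bounded_measurable_seq_deviation_norm
  Rintegral_sqr_deviation_norm_le.
by rewrite (sqr_comb_norm psd_mean_kernel) /comb_sqnorm big_nil add0r mulr1.
Qed.

Variables (dO : measure_display) (Omega : measurableType dO) (Pr : probability Omega R).
Variables (n : nat) (X : 'I_n -> Omega -> S).
Hypothesis n_gt0 : (0 < n)%N.
Hypothesis X_measurable : forall i, measurable_fun setT (X i).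
Hypothesis X_independent : mutually_independent Pr X.
Hypothesis X_law : identically_distributed Pr P X.

Lemma deviation_norm_tail (delta : R) : 0 < delta < 1 ->
  (Pr [set w | (Num.sqrt n%:R * (1 + Num.sqrt (2 * ln delta^-1)) <=
      deviation_norm [seq X i w | i <- enum 'I_n])%R] <= delta%:E)%E.
Proof.
move=> /andP[d0 d1]; have L0 : 0 < ln delta^-1 by rewrite ln_gt0 // invf_gt1.
have n0 : 0 < n%:R :> R by rewrite ltr0n.
pose t := Num.sqrt n%:R * Num.sqrt (2 * ln delta^-1).
have t0 : 0 < t by rewrite mulr_gt0 ?sqrtr_gt0 ?mulr_gt0.
set m := iid_mean P n deviation_norm [::]; pose t' := Num.sqrt n%:R + t - m.
have tt' : t <= t' by rewrite /t' -addrA addrCA lerDl subr_ge0 iid_mean_deviation_norm_le.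
have := mcdiarmid X_measurable X_independent X_law n_gt0
  bounded_measurable_seq_deviation_norm (ltr0n R 2) (lt_le_trans t0 tt')
  bounded_differences_deviation_norm.
rewrite -/m addrC subrK mulrDr mulr1 => /le_trans; apply.
rewrite lee_fin -[leRHS]lnK ?posrE // ler_expR lerNl -lnV ?posrE //.
have -> : ln delta^-1 = 2 * t ^+ 2 / (n%:R * 2 ^+ 2).
  rewrite exprMn !sqr_sqrtr ?(ltW n0) //; last by rewrite mulr_ge0 // ltW.
  by field; rewrite gt_eqF.
by rewrite ler_pM2r ?invr_gt0 ?mulr_gt0 // ler_pM2l // ler_sqr ?nnegrE ?(le_trans (ltW t0)) // ltW.
Qed.

End MeanKernel.

(** * Traces of reproducing kernel Hilbert spaces *)

(* [g] is the composition with [iota] of a function in the ball of radius [C] of the RKHS of [K]. *)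
Definition rkhs_trace_le (R : realType) (S T : Type) (K : S -> S -> R) (iota : T -> S)
    (g : T -> R) (C : R) : Prop :=
  exists (W : nat -> seq (R * S)) (b : nat -> R),
    [/\ forall m, comb_norm K (W m) <= b m, b m @[m --> \oo] --> C &
        forall y, comb_eval K (W m) (iota y) @[m --> \oo] --> g y].

Section RkhsTrace.
Variables (R : realType) (T : Type).
Implicit Types (f g : T -> R) (C D : R).

Lemma rkhs_norm_le_trace (K : T -> T -> R) f C :
  rkhs_norm_le K f C -> rkhs_trace_le K id f C.
Proof.
move=> [u [uf [_ uC]]]; exists u, (fun m => Num.max (comb_norm K (u m)) C).
split=> // [m|]; first by rewrite le_max lexx.
apply/cvgrPdist_le => e e0; have [N uN] := uC e e0; exists N => // m /= Nm.
rewrite distrC ger0_norm ?subr_ge0 ?le_max ?lexx ?orbT //.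
by rewrite lerBlDl ge_max uN // lerDl ltW.
Qed.

Lemma rkhs_trace_le_ge0 (S : Type) (K : S -> S -> R) (iota : T -> S) g C :
  rkhs_trace_le K iota g C -> 0 <= C.
Proof.
move=> [W [b [Wb bC _]]]; apply: (cvgr_to_ge bC); apply: nearW => m.
exact: le_trans (comb_norm_ge0 _ _) (Wb m).
Qed.

Lemma rkhs_trace_leD (S : Type) (K : S -> S -> R) (iota : T -> S) f g C D : psd_kernel K ->
  rkhs_trace_le K iota f C -> rkhs_trace_le K iota g D ->
  rkhs_trace_le K iota (fun x => f x + g x) (C + D).
Proof.
move=> psdK [V [a [Va aC Vf]]] [W [b [Wb bD Wg]]].
exists (fun m => V m ++ W m), (fun m => a m + b m); split=> [m||y].
- by apply: (le_trans (comb_norm_cat psdK _ _)); rewrite lerD.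
- exact: cvgD.
- by under eq_fun do rewrite comb_eval_cat; exact: cvgD.
Qed.

Lemma rkhs_trace_leZ (S : Type) (K : S -> S -> R) (iota : T -> S) a g C :
  rkhs_trace_le K iota g C -> rkhs_trace_le K iota (fun x => a * g x) (`|a| * C).
Proof.
move=> [W [b [Wb bC Wg]]].
exists (fun m => comb_scale a (W m)), (fun m => `|a| * b m); split=> [m||y].
- by rewrite comb_norm_scale ler_wpM2l.
- by apply: cvgM => //; exact: cvg_cst.
- by under eq_fun do rewrite comb_eval_scale; apply: cvgM => //; exact: cvg_cst.
Qed.

Lemma rkhs_trace_le_pullback (S S' : Type) (K : S' -> S' -> R) (phi : S -> S')
    (iota : T -> S) g C :
  rkhs_trace_le (fun s t => K (phi s) (phi t)) iota g C ->
  rkhs_trace_le K (phi \o iota) g C.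
Proof.
move=> [W [b [Wb bC Wg]]]; exists (fun m => comb_map phi (W m)), b; split=> // [m|y].
  by rewrite /comb_norm comb_sqnorm_map; exact: Wb.
by under eq_fun do rewrite comb_eval_map; exact: Wg.
Qed.

End RkhsTrace.

Section TensorKernel.
Variables (R : realType) (S S' : Type) (K : S -> S -> R) (L : S' -> S' -> R).

Definition tensor_kernel (p q : S * S') : R := K p.1 q.1 * L p.2 q.2.

Definition comb_tensor (c : seq (R * S)) (w : seq (R * S')) : seq (R * (S * S')) :=
  [seq (p.1 * q.1, (p.2, q.2)) | p <- c, q <- w].

Lemma comb_sqnorm_tensor c w : comb_sqnorm tensor_kernel (comb_tensor c w) =
  comb_sqnorm K c * comb_sqnorm L w.
Proof.
rewrite /comb_sqnorm big_allpairs_dep big_distrl /=; apply: eq_bigr => p _.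
under eq_bigr do rewrite big_allpairs_dep /=.
rewrite exchange_big big_distrl /=; apply: eq_bigr => p' _.
rewrite big_distrr /=; apply: eq_bigr => q _; rewrite big_distrr /=.
by apply: eq_bigr => q' _; rewrite /tensor_kernel /=; ring.
Qed.

Lemma comb_eval_tensor c w s t : comb_eval tensor_kernel (comb_tensor c w) (s, t) =
  comb_eval K c s * comb_eval L w t.
Proof.
rewrite /comb_eval big_allpairs_dep big_distrl /=; apply: eq_bigr => p _.
by rewrite big_distrr /=; apply: eq_bigr => q _; rewrite /tensor_kernel /=; ring.
Qed.

Lemma rkhs_trace_le_tensor (T : Type) (iota : T -> S) (iota' : T -> S') (f g : T -> R) (C D : R) :
  psd_kernel K -> rkhs_trace_le K iota f C -> rkhs_trace_le L iota' g D ->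
  rkhs_trace_le tensor_kernel (fun x => (iota x, iota' x)) (fun x => f x * g x) (C * D).
Proof.
move=> psdK [V [a [Va aC Vf]]] [W [b [Wb bD Wg]]].
exists (fun m => comb_tensor (V m) (W m)), (fun m => a m * b m); split=> [m||y].
- rewrite /comb_norm comb_sqnorm_tensor sqrtrM; last exact: psdK.2.
  by rewrite ler_pM ?sqrtr_ge0 //; [exact: Va|exact: Wb].
- exact: cvgM.
- by under eq_fun do rewrite comb_eval_tensor; exact: cvgM.
Qed.

End TensorKernel.

(** * Uniform deviation of empirical means *)

Lemma mutually_independent_comp (R : realType) (dO d d' : measure_display)
    (Omega : measurableType dO) (T : measurableType d) (S : measurableType d')
    (Pr : probability Omega R) (n : nat) (X : 'I_n -> Omega -> T) (phi : T -> S) :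
  measurable_fun setT phi -> mutually_independent Pr X ->
  mutually_independent Pr (fun i => phi \o X i).
Proof.
move=> mphi indX J B mB; apply: (indX J (fun i => phi @^-1` B i)) => i.
by rewrite -[X in measurable X]setTI; exact: mphi.
Qed.

Section UniformDeviation.
Variables (R : realType) (d dS : measure_display) (T : measurableType d).
Variables (P : probability T R) (S : measurableType dS) (iota : {mfun T >-> S}).
Variable K : S -> S -> R.
Hypothesis psdK : psd_kernel K.
Hypothesis K_le1 : forall s, K s s <= 1.
Hypothesis K_measurable : measurable_fun setT (fun p : S * S => K p.1 p.2).

Let law : probability S R := distribution P iota.

Lemma bounded_measurable_comb_eval c : bounded_measurable (comb_eval K c).
Proof.
apply: bounded_measurable_sum => p; apply: bounded_measurableM => //.
have -> : K p.2 = K^~ p.2 by apply/funext => y; exact: psdK.1.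
exact: bounded_measurable_kernel_section.
Qed.

Lemma normr_comb_eval_le c s : `|comb_eval K c s| <= comb_norm K c.
Proof.
apply: (le_trans (comb_eval_le_norm psdK _ _)); rewrite ler_piMl ?comb_norm_ge0 //.
by rewrite -[leRHS]sqrtr1 ler_wsqrtr.
Qed.

Lemma cvg_Rintegral_comb_eval (W : nat -> seq (R * S)) (b : nat -> R) (g : T -> R) (C : R) :
  (forall m, comb_norm K (W m) <= b m) -> b m @[m --> \oo] --> C ->
  (forall y, comb_eval K (W m) (iota y) @[m --> \oo] --> g y) ->
  \int[law]_s comb_eval K (W m) s @[m --> \oo] --> \int[P]_y g y.
Proof.
move=> Wb bC Wg.
under eq_fun do
  rewrite (bounded_Rintegral_distribution P iota (bounded_measurable_comb_eval _)).
apply: cvg_bounded_Rintegral bC Wg => [m|m y].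
  exact: bounded_measurable_comp (bounded_measurable_comb_eval _).
exact: le_trans (normr_comb_eval_le _ _) (Wb m).
Qed.

Lemma rkhs_trace_bounded_measurable g C :
  rkhs_trace_le K iota g C -> bounded_measurable g.
Proof.
move=> [W [b [Wb bC Wg]]]; apply: bounded_measurable_cvg bC Wg => [m|m y].
  exact: bounded_measurable_comp (bounded_measurable_comb_eval _).
exact: le_trans (normr_comb_eval_le _ _) (Wb m).
Qed.

Lemma rkhs_trace_deviation_le (xs : seq T) g C : rkhs_trace_le K iota g C ->
  (size xs)%:R * \int[P]_y g y <=
  \sum_(x <- xs) g x + C * deviation_norm law K [seq iota x | x <- xs].
Proof.
move=> [W [b [Wb bC Wg]]]; pose N := deviation_norm law K [seq iota x | x <- xs].
have mean_cvg : (size xs)%:R * \int[law]_s comb_eval K (W m) s @[m --> \oo]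
    --> (size xs)%:R * \int[P]_y g y.
  by apply: cvgM; [exact: cvg_cst|exact: cvg_Rintegral_comb_eval bC Wg].
have sum_cvg : \sum_(x <- xs) comb_eval K (W m) (iota x) + b m * N @[m --> \oo]
    --> \sum_(x <- xs) g x + C * N.
  apply: cvgD; last by apply: cvgM => //; exact: cvg_cst.
  by apply: (cvg_big add_continuous) => x _; exact: Wg.
apply: (ler_cvg_to mean_cvg sum_cvg); apply: nearW => m.
have := deviation_norm_pairing law psdK K_le1 K_measurable (W m) [seq iota x | x <- xs].
rewrite big_map size_map -/N ler_norml => /andP[+ _].
have := ler_wpM2r (comb_norm_ge0 _ _ : 0 <= N) (Wb m); lra.
Qed.

Variables (dO : measure_display) (Omega : measurableType dO) (Pr : probability Omega R).
Variables (n : nat) (X : 'I_n -> Omega -> T).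
Hypothesis n_gt0 : (0 < n)%N.
Hypothesis X_measurable : forall i, measurable_fun setT (X i).
Hypothesis X_independent : mutually_independent Pr X.
Hypothesis X_law : identically_distributed Pr P X.

Lemma deviation_norm_event (delta : R) : 0 < delta -> exists E : set Omega,
  [/\ measurable E, ((1 - delta)%:E <= Pr E)%E & forall w, E w ->
    deviation_norm law K [seq iota (X i w) | i <- enum 'I_n]
      <= Num.sqrt n%:R * (1 + Num.sqrt (2 * ln delta^-1))].
Proof.
move=> d0; have [d1|d1] := leP 1 delta.
  by exists set0; split=> //; rewrite measure0 lee_fin subr_le0.
pose X' i := iota \o X i; set r := _ * _.
have mX' i : measurable_fun setT (X' i) by exact: measurableT_comp.
have indX' : mutually_independent Pr X' by exact: mutually_independent_comp.
have lawX' : identically_distributed Pr law X'.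
  by move=> i B mB; apply: X_law; rewrite -[X in measurable X]setTI; exact: (@measurable_funPT _ _ _ _ iota).
pose N w := deviation_norm law K [seq X' i w | i <- enum 'I_n].
have mN : measurable_fun setT N.
  exact: measurable_sample (bounded_measurable_seq_deviation_norm law psdK K_le1 K_measurable).
pose A := [set w | r <= N w].
have mA : measurable A.
  rewrite (_ : A = N @^-1` `[r, +oo[%classic); last first.
    by apply/seteqP; split => w /=; rewrite in_itv /= andbT.
  by rewrite -[X in measurable X]setTI; exact: mN.
exists (~` A); split; first exact: measurableC.
- rewrite probability_setC // EFinB leeB //.
  by apply: deviation_norm_tail => //; rewrite d0.
- by move=> w /negP; rewrite -ltNge => /ltW.
Qed.

Lemma uniform_deviation (delta : R) : 0 < delta ->
  exists E : set Omega, measurable E /\ ((1 - delta)%:E <= Pr E)%E /\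
    forall w, E w -> forall g C, rkhs_trace_le K iota g C ->
      (\int[P]_x (g x)%:E <= (n%:R^-1 * \sum_(i < n) g (X i w)
        + (Num.sqrt n%:R)^-1 * (1 + Num.sqrt (2 * ln delta^-1)) * C)%:E)%E.
Proof.
move=> d0; have [E [mE PrE EN]] := deviation_norm_event d0.
exists E; split=> //; split=> // w /EN Nw g C gC.
have n0 : 0 < n%:R :> R by rewrite ltr0n.
rewrite -EFin_bounded_Rintegral ?lee_fin; last exact: rkhs_trace_bounded_measurable gC.
rewrite -(ler_pM2l n0); have := rkhs_trace_deviation_le [seq X i w | i <- enum 'I_n] gC.
rewrite size_map size_enum_ord big_map big_enum /= -map_comp => /le_trans; apply.
rewrite mulrDr mulVKf ?gt_eqF // lerD2l.
apply: (le_trans (ler_wpM2l (rkhs_trace_le_ge0 gC) Nw)).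
set a := Num.sqrt n%:R; have a0 : 0 < a by rewrite sqrtr_gt0.
rewrite -[n%:R](@sqr_sqrtr _ n%:R (ltW n0)) -/a.
rewrite [leRHS](_ : _ = C * (a * (1 + Num.sqrt (2 * ln delta^-1)))) //.
by field; rewrite gt_eqF.
Qed.

End UniformDeviation.

(** * Gaussian kernels *)

Section GaussianKernel.
Variables (R : realType) (d : nat).
Implicit Types (sigma : R) (x y : d.-tuple R).

Lemma gauss_kernelxx sigma x : gauss_kernel sigma x x = 1.
Proof.
rewrite /gauss_kernel /sqdist big1 ?oppr0 ?mul0r ?expR0 // => i _.
by rewrite subrr expr0n.
Qed.

Lemma gauss_kernel_div_sqrt2 sigma x y :
  gauss_kernel (sigma / Num.sqrt 2) x y = gauss_kernel sigma x y * gauss_kernel sigma x y.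
Proof.
rewrite /gauss_kernel -expRD; congr expR.
rewrite expr_div_n sqr_sqrtr // mulrCA divff // mulr1.
by rewrite (invfM 2); move: (sigma ^+ 2)^-1 => r; field.
Qed.

Lemma measurable_gauss_kernel sigma (dZ : measure_display) (Z : measurableType dZ)
    (f g : Z -> d.-tuple R) :
  measurable_fun setT f -> measurable_fun setT g ->
  measurable_fun setT (fun z => gauss_kernel sigma (f z) (g z)).
Proof.
move=> mf mg; apply: measurableT_comp => //.
apply: measurable_funM => //; apply: measurableT_comp => //.
apply: measurable_sum => i; apply: measurable_funX; apply: measurable_funB.
- exact: (measurableT_comp (@measurable_tnth _ _ _ i) mf).
- exact: (measurableT_comp (@measurable_tnth _ _ _ i) mg).
Qed.

(* The kernel is [e s * e t * exp (<x, y> / sigma ^ 2)] with [e] a function of one point. *)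
Lemma psd_gauss_kernelM sigma (S : Type) (u : S -> d.-tuple R) (K : S -> S -> R) :
  0 < sigma -> psd_kernel K ->
  psd_kernel (fun s t => gauss_kernel sigma (u s) (u t) * K s t).
Proof.
move=> s0 psdK.
pose e s := expR (- (\sum_(i < d) tnth (u s) i ^+ 2) / (2 * sigma ^+ 2)).
apply: eq_psd_kernel (psd_kernel_rank1M e (psd_kernel_exp_sumM (index_enum 'I_d)
  (fun i s => tnth (u s) i / sigma) psdK)) => s t.
rewrite mulrA /e /gauss_kernel -!expRD; congr (expR _ * _).
rewrite /sqdist -!sumrN !mulr_suml -!big_split /=.
by apply: eq_bigr => i _; field; rewrite gt_eqF.
Qed.

Lemma psd_gauss_kernel sigma : 0 < sigma -> psd_kernel (@gauss_kernel R d sigma).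
Proof.
move=> s0; apply: eq_psd_kernel (psd_gauss_kernelM id s0 (@psd_kernel_cst1 _ _)) => s t.
by rewrite mulr1.
Qed.

Definition gauss_tensor sigma : d.-tuple R * d.-tuple R -> d.-tuple R * d.-tuple R -> R :=
  tensor_kernel (gauss_kernel sigma) (gauss_kernel sigma).

Lemma psd_gauss_tensor sigma : 0 < sigma -> psd_kernel (gauss_tensor sigma).
Proof.
move=> s0; apply: eq_psd_kernel
  (psd_gauss_kernelM fst s0 (psd_gauss_kernelM snd s0 (@psd_kernel_cst1 _ _))) => s t.
by rewrite mulr1.
Qed.

Lemma gauss_tensorxx sigma p : gauss_tensor sigma p p = 1.
Proof. by rewrite /gauss_tensor /tensor_kernel !gauss_kernelxx mulr1. Qed.

Lemma measurable_gauss_tensor sigma :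
  measurable_fun setT (fun p : (d.-tuple R * d.-tuple R) * (d.-tuple R * d.-tuple R) =>
    gauss_tensor sigma p.1 p.2).
Proof.
by apply: measurable_funM; apply: measurable_gauss_kernel; exact: measurableT_comp.
Qed.

Lemma gauss_tensor_trace_sqr sigma (g : d.-tuple R -> R) L :
  gauss_rkhs_norm_le (sigma / Num.sqrt 2) g L ->
  rkhs_trace_le (gauss_tensor sigma) (@diagonal _) g L.
Proof.
move=> /rkhs_norm_le_trace gL; apply: (rkhs_trace_le_pullback (phi := @diagonal _) (iota := id)).
suff <- : gauss_kernel (sigma / Num.sqrt 2) =
  fun x y => gauss_tensor sigma (diagonal x) (diagonal y) by [].
by apply/funext => x; apply/funext => y; exact: gauss_kernel_div_sqrt2.
Qed.

Lemma square_loss_trace sigma (f h : d.-tuple R -> R) (Lf2 Lf Lh2 Lh : R) : 0 < sigma ->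
  gauss_rkhs_norm_le (sigma / Num.sqrt 2) (fun x => f x ^+ 2) Lf2 ->
  gauss_rkhs_norm_le sigma f Lf ->
  gauss_rkhs_norm_le (sigma / Num.sqrt 2) (fun x => h x ^+ 2) Lh2 ->
  gauss_rkhs_norm_le sigma h Lh ->
  rkhs_trace_le (gauss_tensor sigma) (@diagonal _) (fun x => (f x - h x) ^+ 2)
    (Lf2 + Lh2 + 2 * Lf * Lh).
Proof.
move=> s0 /gauss_tensor_trace_sqr f2L /rkhs_norm_le_trace fL.
move=> /gauss_tensor_trace_sqr h2L /rkhs_norm_le_trace hL.
have psdG := psd_gauss_tensor s0.
have fhL := rkhs_trace_le_tensor (psd_gauss_kernel s0) fL hL.
have := rkhs_trace_leD psdG (rkhs_trace_leD psdG f2L h2L) (rkhs_trace_leZ (- 2) fhL).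
rewrite normrN ger0_norm // mulrA; congr rkhs_trace_le.
by apply/funext => x; ring.
Qed.

End GaussianKernel.

Theorem theorem3 (R : realType) (d : nat) (sigma : R) (hsigma : 0 < sigma)
  (dO : measure_display) (Omega : measurableType dO) (Pr : probability Omega R)
  (P : probability (d.-tuple R) R)
  (n : nat) (hn : (0 < n)%N) (X : 'I_n -> Omega -> d.-tuple R)
  (hXmeas : forall i, measurable_fun setT (X i))
  (hXind : mutually_independent Pr X)
  (hXlaw : identically_distributed Pr P X)
  (h : d.-tuple R -> R) (Lh2 Lh Lf2 Lf : R)
  (hh2 : gauss_rkhs_norm_le (sigma / Num.sqrt 2) (fun x => h x ^+ 2) Lh2)
  (hh : gauss_rkhs_norm_le sigma h Lh)
  (delta : R) (hdelta : 0 < delta) :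
  exists E : set Omega, measurable E /\ ((1 - delta)%:E <= Pr E)%E /\
    forall omega, E omega ->
    forall f : d.-tuple R -> R,
      gauss_rkhs_norm_le (sigma / Num.sqrt 2) (fun x => f x ^+ 2) Lf2 ->
      gauss_rkhs_norm_le sigma f Lf ->
      (\int[P]_x ((f x - h x) ^+ 2)%:E <=
        ((n%:R)^-1 * \sum_(i < n) (f (X i omega) - h (X i omega)) ^+ 2
         + 2 / Num.sqrt n%:R * (1 + Num.sqrt (ln (delta^-1) / 2))
           * (Lf2 + Lh2 + 2 * Lf * Lh))%:E)%E.
Proof.
have K_le1 p : @gauss_tensor R d sigma p p <= 1 by rewrite gauss_tensorxx.
have [E [mE [PrE dev]]] := uniform_deviation (@diagonal _) (psd_gauss_tensor d hsigma)
  K_le1 (@measurable_gauss_tensor _ _ sigma) hn hXmeas hXind hXlaw hdelta.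
exists E; split=> //; split=> // w Ew f f2L fL.
have loss := square_loss_trace hsigma f2L fL hh2 hh.
apply: le_trans (dev w Ew _ _ loss) _; rewrite lee_fin lerD2l.
apply: ler_wpM2r; first exact: rkhs_trace_le_ge0 loss.
have -> : Num.sqrt (2 * ln delta^-1) = 2 * Num.sqrt (ln delta^-1 / 2).
  rewrite (_ : 2 * ln _ = 2 ^+ 2 * (ln delta^-1 / 2)); last by field.
  by rewrite sqrtrM ?sqr_ge0 // sqrtr_sqr ger0_norm.
by rewrite [2 / _]mulrC -mulrA ler_wpM2l ?invr_ge0 ?sqrtr_ge0 //; lra.
Qed.
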